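(* Let $\Delta=\bigsqcup_{i\in\mathbb Z}\Delta(i)$ be a $\mathbb Z$-grading of an irreducible reduced crystallographic root system with compatible positive system, Weyl group $W$, and let $W^0$, $\tau$, $w_{I,\min}$, $w_{I,\max}$ be as in the context. For every lower ideal $I$ of $\Delta(1)$, $$\tau^{-1}(I)=\{w\in W^0\mid w_{I,\min}\le w\le w_{I,\max}\},$$ where $\le$ is the weak Bruhat order ($w\le w'$ iff $N(w)\subset N(w')$). In particular $\tau^{-1}(I)$ is an interval of $W^0$ with respect to the weak order.
   Context: A $\mathbb Z$-grading: $\Delta=\bigsqcup_i\Delta(i)$ with $\gamma_1+\gamma_2\in\Delta(i_1+i_2)$ whenever $\gamma_j\in\Delta(i_j)$ and $\gamma_1+\gamma_2\in\Delta$; compatibility: $\Delta^+=\Delta(0)^+\sqcup\bigsqcup_{i\ge1}\Delta(i)$ with $\Delta(0)^+$ a positive system of $\Delta(0)$; $\Delta(\ge1)=\bigsqcup_{j\ge1}\Delta(j)$. Order: $\mu\preccurlyeq\gamma$ iff $\gamma-\mu$ is a nonnegative integer combination of simple roots; lower ideals of $\Delta(1)$ are its downward closed subsets; $I^c=\Delta(1)\setminus I$. $N(w)=\{\gamma\in\Delta^+\mid w(\gamma)\in-\Delta^+\}$. $W^0=\{w\in W\mid w(\alpha)\in\Delta^+\ \forall\alpha\in\Delta(0)^+\}$. $\tau:W^0\to\{\text{lower ideals of }\Delta(1)\}$, $\tau(w)=N(w)\cap\Delta(1)$. For $J\subset\Delta^+$: $J^1=J$, $J^k=(J+J^{k-1})\cap\Delta$,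 $\langle J\rangle=\bigcup_{k\ge1}J^k$. For a lower ideal $I$ of $\Delta(1)$, $w_{I,\min}\in W$ is the unique element with $N(w_{I,\min})=\langle I\rangle$ and $w_{I,\max}$ is the unique element with $N(w_{I,\max})=\Delta(\ge1)\setminus\langle I^c\rangle$ (these sets are bi-convex, so such elements exist, and both lie in $W^0$). *)

(* Defs.v *)
From HB Require Import structures.
From mathcomp Require Import all_boot all_order all_algebra.
From mathcomp Require Import all_classical reals.

Set Implicit Arguments.
Unset Strict Implicit.
Unset Printing Implicit Defensive.

Import Order.TTheory GRing.Theory Num.Theory.

Local Open Scope classical_set_scope.
Local Open Scope ring_scope.

(* The ambient Euclidean space is a finite-dimensional real vector space V with
   an inner product dot. *)

Section Reflections.
Context (R : realType) (V : vectType R) (dot : {dot V for idfun}).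
Implicit Types a v : V.

Definition cartan v a : R := 2 * dot v a / dot a a.

Definition refl_fun a v : V := v - cartan v a *: a.

Fact refl_fun_linear a : linear (refl_fun a).
Proof.
move=> k u v; rewrite /refl_fun /cartan linearPl /=.
rewrite scalerBr scalerA mulrDr mulrDl scalerDl opprD addrACA.
by rewrite mulrCA -!mulrA.
Qed.

HB.instance Definition _ a :=
  GRing.isLinear.Build R V V _ (refl_fun a) (refl_fun_linear a).

Definition reflection a : 'End(V) := linfun (refl_fun a).

End Reflections.

Section RootSystems.
Context (R : realType) (V : vectType R) (dot : {dot V for idfun}).

Record root_system (D : set V) : Prop := RootSystem {
  root_finite : finite_set D;
  root_span : forall U : {vspace V}, D `<=` [set` U] -> U = fullv;
  root_neq0 : ~ D 0;
  root_refl : forall a b, D a -> D b -> D (reflection dot a b);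
  root_int : forall a b, D a -> D b -> cartan dot b a \is a Num.int }.

Definition reduced (D : set V) : Prop :=
  forall (a : V) (c : R), D a -> D (c *: a) -> c = 1 \/ c = -1.

Definition irreducible (D : set V) : Prop :=
  D !=set0 /\
  ~ exists A B : set V, [/\ A !=set0, B !=set0, D = A `|` B
      & forall a b, A a -> B b -> dot a b = 0].

Inductive weyl (D : set V) : 'End(V) -> Prop :=
| weyl_id : weyl D \1%VF
| weyl_reflection a : D a -> weyl D (reflection dot a)
| weyl_comp f g : weyl D f -> weyl D g -> weyl D (f \o g)%VF
| weyl_inv f : weyl D f -> weyl D (f^-1)%VF.

End RootSystems.

Section PositiveSystems.
Context (R : realType) (V : vectType R).
Implicit Types D P I J : set V.

(* No spanning is required, so that the notion also applies to Delta(0). *)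
Record positive_system D P : Prop := PositiveSystem {
  pos_union : D = P `|` [set - a | a in P];
  pos_disj : P `&` [set - a | a in P] = set0;
  pos_closed : forall a b, P a -> P b -> D (a + b) -> P (a + b) }.

Definition simple_roots P : set V :=
  [set a | P a /\ ~ exists b c, [/\ P b, P c & a = b + c]].

(* As P is finite in all uses, the finitely supported sum is a plain sum. *)
Definition root_le P (m g : V) : Prop :=
  exists c : V -> nat, g - m = \sum_(a \in simple_roots P) a *+ c a.

Record Zgrading D (Dg : int -> set V) : Prop := ZGrading {
  gr_union : D = \bigcup_i Dg i;
  gr_disj : trivIset setT Dg;
  gr_add : forall i1 i2 g1 g2,
    Dg i1 g1 -> Dg i2 g2 -> D (g1 + g2) -> Dg (i1 + i2) (g1 + g2) }.

Definition gr_ge1 (Dg : int -> set V) : set V :=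
  \bigcup_(i in [set i : int | 1 <= i]) Dg i.

Definition gr0_pos (Dg : int -> set V) P : set V := Dg 0 `&` P.

Definition compatible (Dg : int -> set V) P : Prop :=
  positive_system (Dg 0) (gr0_pos Dg P) /\ P = gr0_pos Dg P `|` gr_ge1 Dg.

Definition lower_ideal (Dg : int -> set V) P I : Prop :=
  I `<=` Dg 1 /\ forall m g, Dg 1 m -> I g -> root_le P m g -> I m.

(* [root_pow D J n] is J^(n+1): the exponent is shifted by one. *)
Fixpoint root_pow D J (n : nat) : set V :=
  if n is n'.+1 then [set x + y | x in J & y in root_pow D J n'] `&` D else J.

Definition root_gen D J : set V := \bigcup_n root_pow D J n.

Definition inversions P (w : 'End(V)) : set V := [set g | P g /\ P (- w g)].

Definition weak_le P (w w' : 'End(V)) : Prop :=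
  inversions P w `<=` inversions P w'.

Definition weak_interval P (S T : set 'End(V)) : Prop :=
  exists u v, [/\ S u, S v, weak_le P u v
    & T = [set w | [/\ S w, weak_le P u w & weak_le P w v]]].

Definition tau (Dg : int -> set V) P (w : 'End(V)) : set V :=
  inversions P w `&` Dg 1.

End PositiveSystems.

Section MinimalMaximalElements.
Context (R : realType) (V : vectType R) (dot : {dot V for idfun}).
Context (D : set V) (Dg : int -> set V) (P : set V).

Definition weyl0 : set 'End(V) :=
  [set w | weyl dot D w /\ forall a, gr0_pos Dg P a -> P (w a)].

Definition tau_fiber (I : set V) : set 'End(V) :=
  [set w | weyl0 w /\ tau Dg P w = I].

Definition is_wmin (I : set V) (w : 'End(V)) : Prop :=
  weyl dot D w /\ inversions P w = root_gen D I.

Definition is_wmax (I : set V) (w : 'End(V)) : Prop :=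
  weyl dot D w /\
  inversions P w = gr_ge1 Dg `\` root_gen D (Dg 1 `\` I).

End MinimalMaximalElements.

(* Main.v *)
Require Import Defs.
From mathcomp Require Import all_boot all_order all_algebra.
From mathcomp Require Import all_classical reals.
From mathcomp Require Import lra ring zify.

Set Implicit Arguments.
Unset Strict Implicit.
Unset Printing Implicit Defensive.

Import Order.TTheory GRing.Theory Num.Theory.

Local Open Scope classical_set_scope.
Local Open Scope ring_scope.

(* For w in W the set N(w) and its complement in P are both closed under sums of
   roots.  Hence, for w in W^0 with tau w = I, N(w) contains <I> and, lying in
   Delta(>= 1) and missing I^c, it also misses <I^c>; conversely <I> and <I^c>
   have degree-1 parts I and I^c, so the bounds force tau w = I.

   For the bounds to be attained, <I> and Delta(>= 1) \ <I^c> must be biconvex.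
   By [root_genP], <J> consists of the roots that are nonempty sums of elements of
   J.  If a + b = v is in <I>, one removes from v a summand x with (v, x) > 0; then
   (a, x) > 0 or (b, x) > 0, say the former, so that a - x is 0 or a root, and one
   concludes by induction on the number of summands, using that I is a lower ideal
   when a - x is negative.  The argument for <I^c> is similar.

   Finally a biconvex B is N(w) for a unique w: (P \ B) together with -B is a
   positive system, positive systems are conjugate, and the stabilizer of a
   positive system is trivial by the deletion property. *)

(** * Reflections and products of reflections in a Euclidean space *)

Section InnerProduct.
Context (R : realType) (V : vectType R) (dot : {dot V for idfun}).
Implicit Types (a b u v : V) (l : seq V).

Lemma dotC u v : dot u v = dot v u.
Proof. by rewrite hermC expr0 mul1r. Qed.

Lemma dot_gt0 v : (0 < dot v v) = (v != 0).
Proof.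
have [->|vN0] := eqVneq v 0; first by rewrite linear0l ltxx.
exact: neq0_dnorm_gt0.
Qed.

Lemma dot_sum_gt0 v l : 0 < dot v (\sum_(x <- l) x) ->
  exists2 x, x \in l & 0 < dot v x.
Proof.
elim: l => [|x l IH]; first by rewrite big_nil linear0r ltxx.
rewrite big_cons linearDr /= => h.
have [vx|vx] := ltP 0 (dot v x); first by exists x; rewrite ?mem_head.
have [|y yl vy] := IH; first by lra.
by exists y; rewrite // inE yl orbT.
Qed.

Lemma reflectionE a b : reflection dot a b = b - cartan dot b a *: a.
Proof. by rewrite lfunE. Qed.

Lemma cartanxx a : a != 0 -> cartan dot a a = 2.
Proof. by rewrite -dot_gt0 /cartan => a0; rewrite mulfK // gt_eqF. Qed.

Lemma reflection_id a : a != 0 -> reflection dot a a = - a.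
Proof.
move=> a0; rewrite reflectionE cartanxx // scaler_nat mulr2n.
by rewrite opprD addrA subrr sub0r.
Qed.

Lemma reflectionK a : a != 0 -> involutive (reflection dot a).
Proof.
move=> a0 v; rewrite [in LHS](reflectionE a v) linearB linearZ /=.
by rewrite reflection_id // reflectionE scalerN opprK subrK.
Qed.

Lemma reflectionN a : reflection dot (- a) = reflection dot a.
Proof.
apply/lfunP => v; rewrite !reflectionE /cartan.
by rewrite !linearNr !linearNl /= opprK mulrN mulNr scaleNr scalerN opprK.
Qed.

Definition isometric (f : V -> V) := forall u v, dot (f u) (f v) = dot u v.

Lemma reflection_isometric a : a != 0 -> isometric (reflection dot a).
Proof.
move=> a0 u v; have a1 : dot a a != 0 by rewrite gt_eqF // dot_gt0.
rewrite !reflectionE !linearBr !linearBl !linearZr_LR !linearZl_LR /=.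
rewrite /cartan (dotC a v).
by field.
Qed.

Lemma reflection_conj (f : 'End(V)) a v :
  isometric f -> f (reflection dot a v) = reflection dot (f a) (f v).
Proof. by move=> fI; rewrite !reflectionE linearB linearZ /cartan !fI. Qed.

Definition refl_word l : 'End(V) :=
  foldr (fun a f => (reflection dot a \o f)%VF) \1%VF l.

Lemma refl_word_nil v : refl_word [::] v = v.
Proof. by rewrite /= id_lfunE. Qed.

Lemma refl_word_cons a l v : refl_word (a :: l) v = reflection dot a (refl_word l v).
Proof. by rewrite /= comp_lfunE. Qed.

Lemma refl_word_cat l l' v : refl_word (l ++ l') v = refl_word l (refl_word l' v).
Proof.
by elim: l => [|a l IH]; rewrite ?refl_word_nil // cat_cons !refl_word_cons IH.
Qed.

Lemma refl_word_rcons l a v : refl_word (rcons l a) v = refl_word l (reflection dot a v).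
Proof. by rewrite -cats1 refl_word_cat refl_word_cons refl_word_nil. Qed.

Lemma refl_word_isometric l : [set` l] `<=` [set a | a != 0] -> isometric (refl_word l).
Proof.
elim: l => [|a l IH] l0 u v; first by rewrite !refl_word_nil.
rewrite !refl_word_cons reflection_isometric; last exact/l0/mem_head.
by apply: IH => x xl; apply: l0; rewrite /= inE xl orbT.
Qed.

Lemma refl_word_revK l : [set` l] `<=` [set a | a != 0] ->
  cancel (refl_word (rev l)) (refl_word l).
Proof.
elim: l => [|a l IH] l0 v; first by rewrite /= !id_lfunE.
rewrite rev_cons refl_word_rcons refl_word_cons IH; last first.
  by move=> x xl; apply: l0; rewrite /= inE xl orbT.
by rewrite reflectionK //; apply/l0/mem_head.
Qed.

Lemma refl_wordK l : [set` l] `<=` [set a | a != 0] ->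
  cancel (refl_word l) (refl_word (rev l)).
Proof.
move=> l0; rewrite -{1}(revK l); apply: refl_word_revK => x /=.
by rewrite mem_rev; apply: l0.
Qed.
End InnerProduct.

(** * Positive roots, simple roots and simple reflections *)

Section PositiveRoots.
Context (R : realType) (V : vectType R) (dot : {dot V for idfun}).
Context (D : set V) (Droot : root_system dot D).
Implicit Types (a b u v x : V) (l : seq V) (J P : set V).

Lemma root_nz a : D a -> a != 0.
Proof. by move=> Da; apply/eqP => a0; apply: (root_neq0 Droot); rewrite -a0. Qed.

Lemma rootN a : D a -> D (- a).
Proof.
by move=> Da; rewrite -(reflection_id dot (root_nz Da)); apply: root_refl.
Qed.

Lemma cartan_eq1_or_dot_le a b : D a -> D b -> 0 < dot a b ->
  cartan dot a b = 1 \/ dot b b <= dot a b.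
Proof.
move=> Da Db ab; have b0 : 0 < dot b b by rewrite dot_gt0 root_nz.
have c0 : 0 < cartan dot a b by rewrite /cartan divr_gt0 // mulr_gt0.
have /intrP[m mE] := root_int Droot Db Da.
move: c0; rewrite mE ltr0z => m0.
have [->|m1] := eqVneq m 1; [by left | right].
have : 2 <= m%:~R :> R by rewrite (ler_int _ 2); lia.
by rewrite -mE /cartan ler_pdivlMr // ler_pM2l.
Qed.

(** If one of the two Cartan numbers is 1, a single reflection yields [a - b] up to sign. Otherwise
    (a, b) is at least (a, a) and (b, b), so (a - b, a - b) <= 0 and [a = b]. *)
Lemma root_sub a b : D a -> D b -> 0 < dot a b -> a <> b -> D (a - b).
Proof.
move=> Da Db ab aNb.
have [m1|bb] := cartan_eq1_or_dot_le Da Db ab.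
  by have := root_refl Droot Db Da; rewrite reflectionE m1 scale1r.
have [|n1|aa] := @cartan_eq1_or_dot_le b a Db Da; first by rewrite dotC.
  have := root_refl Droot Da Db; rewrite reflectionE n1 scale1r => /rootN.
  by rewrite opprB.
have : 0 < dot (a - b) (a - b).
  by rewrite dot_gt0 subr_eq0; apply/eqP.
by move: aa; rewrite linearBr !linearBl /= (dotC dot b a); lra.
Qed.

Lemma root_add a b : D a -> D b -> dot a b < 0 -> a + b != 0 -> D (a + b).
Proof.
move=> Da Db ab abN0; rewrite -[b]opprK; apply: root_sub => //; first exact: rootN.
  by rewrite linearNr /= oppr_gt0.
by move=> aE; move: abN0; rewrite aE addNr eqxx.
Qed.

Section Fixed.
Context (P : set V) (Ppos : positive_system D P).

Lemma pos_root a : P a -> D a.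
Proof. by rewrite (pos_union Ppos); left. Qed.

Lemma posN a : P a -> ~ P (- a).
Proof.
move=> Pa PNa; suff : (P `&` [set - a | a in P]) a by rewrite (pos_disj Ppos).
by split=> //; exists (- a); rewrite ?opprK.
Qed.

Lemma root_posVneg a : D a -> P a \/ P (- a).
Proof.
by rewrite (pos_union Ppos) => -[|[b Pb <-]]; [left | right; rewrite opprK].
Qed.

(** In a vanishing sum the first root [a] has negative inner product with some other summand [x], so
    [a + x] is again a positive root; merging the two shortens the list. *)
Lemma pos_sum_neq0 l : l != [::] -> [set` l] `<=` P -> \sum_(x <- l) x != 0.
Proof.
have [n] := ubnP (size l); elim: n l => // n IH [//|a l] /= sl _ lP.
have Pa : P a by apply/lP/mem_head.
apply/eqP; rewrite big_cons => /eqP; rewrite addr_eq0 => /eqP aE.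
have aa : 0 < dot a a by rewrite dot_gt0 root_nz //; apply: pos_root.
have : 0 < dot (- a) (\sum_(x <- l) x).
  by move: aa; rewrite [in X in _ < dot _ X -> _]aE linearNr linearNl.
case/dot_sum_gt0 => x xl; rewrite linearNl /= oppr_gt0 => ax.
have Px : P x by apply: lP; rewrite /= inE xl orbT.
have Pax : P (a + x).
  apply: (pos_closed Ppos) => //; apply: root_add => //; try exact: pos_root.
  by apply/negP; rewrite addr_eq0 => /eqP aNx; apply: (posN Px); rewrite -aNx.
have := IH (a + x :: rem x l); rewrite /= size_rem // big_cons -addrA.
rewrite -(big_rem x (P := predT) (F := id)) //=.
rewrite [X in X != 0](_ : _ = 0); last by rewrite aE addNr.
rewrite eqxx.
move=> IH'; suff : false by []; apply: IH' => //.
  by case: (l) xl sl.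
move=> y /=; rewrite inE => /orP[/eqP-> //|/mem_rem yl].
by apply: lP; rewrite /= inE yl orbT.
Qed.

Lemma pos_add_neq0 a b : P a -> P b -> a + b != 0.
Proof.
move=> Pa Pb; apply/negP; rewrite addrC addr_eq0 => /eqP bE.
by apply: (posN Pa); rewrite -bE.
Qed.

(** Otherwise the opposite of the sum, put in front of [l], would give positive roots adding up to
    0. *)
Lemma root_sum_pos l : D (\sum_(x <- l) x) -> [set` l] `<=` P ->
  P (\sum_(x <- l) x).
Proof.
move=> Ds lP; have [//|Ns] := root_posVneg Ds.
have := @pos_sum_neq0 ((- \sum_(x <- l) x) :: l) isT.
rewrite big_cons addNr eqxx => H; suff : false by []; apply: H.
by move=> y /=; rewrite inE => /orP[/eqP-> //|yl]; apply: lP.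
Qed.

Lemma pos_ind (Q : V -> Prop) :
  (forall a, P a ->
    (forall b l, P b -> [set` l] `<=` P -> l != [::] ->
      a = b + \sum_(x <- l) x -> Q b) -> Q a) ->
  forall a, P a -> Q a.
Proof.
(* Induction on the number of positive roots below [a]. *)
move=> step; have /finite_seqP[s DE] := root_finite Droot.
pose below a b := `[< P b /\ exists2 l, [set` l] `<=` P & a = b + \sum_(x <- l) x >].
suff H n a : (count (below a) s < n)%N -> P a -> Q a.
  by move=> a; apply: (H _ a (ltnSn _)).
elim: n a => // n IH a; rewrite ltnS => an Pa; apply: (step) => // b l Pb lP l0 aE.
apply: IH => //; apply: leq_trans an.
have aD : a \in s by move: (pos_root Pa); rewrite DE.
have cP (p : pred V) : count p s = (p a + count p (rem a s))%N.
  by have /permP -> := perm_to_rem aD.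
rewrite !cP.
(* The count drops strictly because [a] is below itself but not below [b]: otherwise a nonempty list
   of positive roots would sum to 0. *)
have -> : below b a = false.
  apply/negbTE/asboolP => -[_ [l' l'P bE]].
  have := @pos_sum_neq0 (l ++ l').
  rewrite big_cat /= => H; suff : false by [].
  have -> : false = (0 != 0 :> V) by rewrite eqxx.
  have := H; rewrite (_ : \sum_(x <- l) x + \sum_(x <- l') x = 0).
    apply; first by case: (l) l0.
    by move=> x /=; rewrite mem_cat => /orP[/lP|/l'P].
  by apply: (addrI b); rewrite addr0 addrA -aE [RHS]bE.
have -> : below a a.
  by apply/asboolP; split=> //; exists [::]; rewrite ?big_nil ?addr0.
rewrite add0n add1n ltnS; apply: sub_count => x /asboolP[Px [l' l'P bE]].
apply/asboolP; split=> //; exists (l' ++ l).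
  by move=> y /=; rewrite mem_cat => /orP[/l'P|/lP].
by rewrite big_cat /= addrA -bE.
Qed.

Lemma simple_pos a : simple_roots P a -> P a. Proof. by case. Qed.

Lemma pos_simple_sum a : P a ->
  exists2 l, [set` l] `<=` simple_roots P & a = \sum_(x <- l) x.
Proof.
elim/pos_ind => {}a Pa IH.
have [sa|] := pselect (simple_roots P a).
  exists [:: a]; last by rewrite big_seq1.
  by move=> x /=; rewrite inE => /eqP->.
move=> /not_andP[//|/contrapT[b [c [Pb Pc aE]]]].
have sub1 x : P x -> [set` [:: x]] `<=` P by move=> Px y /=; rewrite inE => /eqP->.
have [l1 l1S bE] : exists2 l, [set` l] `<=` simple_roots P & b = \sum_(x <- l) x.
  by apply: (IH b [:: c] Pb (sub1 _ Pc)) => //; rewrite big_seq1.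
have [l2 l2S cE] : exists2 l, [set` l] `<=` simple_roots P & c = \sum_(x <- l) x.
  by apply: (IH c [:: b] Pc (sub1 _ Pb)) => //; rewrite big_seq1 addrC.
exists (l1 ++ l2); last by rewrite big_cat /= -bE -cE.
by move=> x /=; rewrite mem_cat => /orP[/l1S|/l2S].
Qed.

Lemma pos_root_le m a : P a -> root_le P m (m + a).
Proof.
move=> /pos_simple_sum[l lS ->]; exists (fun x => count_mem x l).
rewrite addrC addKr (fsbigE (undup l)) ?undup_uniq //; last first.
- by move=> x _; rewrite mem_undup => /count_memPn->; rewrite mulr0n.
- by move=> x /=; rewrite mem_undup => /lS.
apply/esym; rewrite big_seq_cond (eq_bigl (fun x => x \in undup l)); last first.
  move=> x; rewrite mem_undup; case xl: (x \in l) => //=.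
  by rewrite mem_set //; apply: lS.
by rewrite -big_seq -[RHS]big_undup_iterop_count; apply: eq_bigr.
Qed.

Hypothesis Dred : reduced D.

(** Suppose s_a b is negative. If (b, a) > 0, then [b - a] is a positive root and, by induction, a =
    s_a(b - a) + (- s_a b) splits the simple root [a]. If (b, a) <= 0, then - s_a b, [b] and copies
    of [a] sum to 0. *)
Lemma simple_reflection_pos a b : simple_roots P a -> P b -> b <> a ->
  P (reflection dot a b).
Proof.
move=> [Pa aS]; have Da := pos_root Pa; elim/pos_ind => {}b Pb IH bNa.
have Db := pos_root Pb.
have Dsb := root_refl Droot Da Db.
have [//|PN] := root_posVneg Dsb.
have [ba|ba] := ltP 0 (dot b a).
  have Dba := root_sub Db Da ba bNa.
  have [Pba|] := root_posVneg Dba; last first.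
    rewrite opprB => Pab; case: aS; exists b, (a - b); split=> //.
    by rewrite addrCA subrr addr0.
  have Psba : P (reflection dot a (b - a)).
    apply: (IH _ [:: a]) => //; rewrite ?big_seq1 ?subrK //.
      by move=> x /=; rewrite inE => /eqP->.
    (* If [b - a = a], then [b] is twice [a], which reducedness forbids. *)
    move=> /eqP; rewrite subr_eq => /eqP bE.
    have := @Dred a 2 Da; rewrite scaler_nat mulr2n -bE => /(_ Db)[] /eqP.
      by rewrite (eqr_nat _ 2 1).
    by rewrite -subr_eq0 opprK -(natrD _ 2 1) pnatr_eq0.
  case: aS; exists (reflection dot a (b - a)), (- reflection dot a b); split=> //.
  by rewrite linearB /= reflection_id ?root_nz // opprK addrAC subrr add0r.
have /intrP[m mE] := root_int Droot Da Db.
have m0 : (m <= 0)%R.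
  rewrite -(@lerz0 R) -mE /cartan pmulr_lle0 ?invr_gt0 ?dot_gt0 ?root_nz //.
  by rewrite pmulr_rle0.
exfalso; have := @pos_sum_neq0 (- reflection dot a b :: b :: nseq `|m|%N a) isT.
rewrite !big_cons big_nseq iter_addr_0 reflectionE mE.
rewrite opprB addrA subrK -scaler_nat -scalerDl natr_absz.
rewrite ler0_norm // intrN subrr scale0r eqxx => H; suff : false by [].
apply: H => x /=; rewrite !inE => /or3P[/eqP->|/eqP->|] //.
  by rewrite -opprB -mE -reflectionE.
by rewrite mem_nseq => /andP[_ /eqP->].
Qed.

End Fixed.
End PositiveRoots.

(** * The Weyl group: words in simple reflections and inversion sets *)

Section WeylGroup.
Context (R : realType) (V : vectType R) (dot : {dot V for idfun}).
Context (D : set V) (Droot : root_system dot D) (Dred : reduced D).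
Implicit Types (a b u v x : V) (l : seq V).

Lemma refl_word_root l a : [set` l] `<=` D -> D a -> D (refl_word dot l a).
Proof.
elim: l => [|b l IH] lD Da; first by rewrite refl_word_nil.
rewrite refl_word_cons; apply: (root_refl Droot); first exact/lD/mem_head.
by apply: IH => // x xl; apply: lD; rewrite /= inE xl orbT.
Qed.

Lemma refl_word_weyl l : [set` l] `<=` D -> weyl dot D (refl_word dot l).
Proof.
elim: l => [|b l IH] lD; first exact: weyl_id.
apply: weyl_comp; first exact/weyl_reflection/lD/mem_head.
by apply: IH => // x xl; apply: lD; rewrite /= inE xl orbT.
Qed.

Section Simple.
Context (P : set V) (Ppos : positive_system D P).

Let simple_root a : simple_roots P a -> D a.
Proof. by move=> /simple_pos/(pos_root Ppos). Qed.

Let simple_words l : [set` l] `<=` simple_roots P -> [set` l] `<=` D.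
Proof. by move=> lS x /lS/simple_root. Qed.

Let simple_nz l : [set` l] `<=` simple_roots P -> [set` l] `<=` [set a | a != 0].
Proof. by move=> /simple_words lD x /lD/(root_nz Droot). Qed.

Lemma pos_simple_dot a : P a -> exists2 b, simple_roots P b & 0 < dot a b.
Proof.
move=> Pa; have [l lS aE] := pos_simple_sum Droot Ppos Pa.
have : 0 < dot a a by rewrite dot_gt0 (root_nz Droot (pos_root Ppos Pa)).
rewrite [in X in _ < X -> _]aE; rewrite -[X in dot X _]aE.
by case/dot_sum_gt0 => b /lS; exists b.
Qed.

(** For a simple [b] with (a, b) > 0, the root s_b a is lower than [a] and s_a = s_b s_{s_b a} s_b,
    so induction applies. *)
Lemma reflection_word a : D a ->
  exists2 l, [set` l] `<=` simple_roots P & reflection dot a = refl_word dot l.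
Proof.
suff H c : P c ->
    exists2 l, [set` l] `<=` simple_roots P & reflection dot c = refl_word dot l.
  by move=> /(root_posVneg Ppos)[/H//|/H]; rewrite reflectionN.
elim/(pos_ind Droot Ppos) => {}a Pa IH; have Da := pos_root Ppos Pa.
have [b Sb ab] := pos_simple_dot Pa; have Pb := simple_pos Sb.
have Db := simple_root Sb.
have [->|/eqP aNb] := eqVneq a b.
  exists [:: b]; first by move=> x /=; rewrite inE => /eqP->.
  by apply/lfunP => v; rewrite refl_word_cons refl_word_nil.
have Psba := simple_reflection_pos Droot Ppos Dred Sb Pa aNb.
have /natrP[n nE] : cartan dot a b \is a Num.nat.
  rewrite natrEint (root_int Droot Db Da) /= /cartan divr_ge0 ?mulr_ge0 ?ltW //.
  by rewrite dot_gt0 (root_nz Droot Db).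
have aE : a = reflection dot b a + \sum_(x <- nseq n b) x.
  by rewrite big_nseq iter_addr_0 reflectionE nE scaler_nat subrK.
have [||l lS sE] := IH _ (nseq n b) Psba _ _ aE.
- by move=> x /=; rewrite mem_nseq => /andP[_ /eqP->].
- case: (n) nE => // /eqP; rewrite gt_eqF // /cartan divr_gt0 ?mulr_gt0 //.
  by rewrite dot_gt0 (root_nz Droot Db).
exists (b :: rcons l b).
  by move=> x /=; rewrite inE mem_rcons inE => /or3P[/eqP->|/eqP->|/lS].
have b0 := root_nz Droot Db.
apply/lfunP => v; rewrite refl_word_cons refl_word_rcons -sE.
rewrite -(reflection_conj _ _ (reflection_isometric dot b0)).
by rewrite (reflectionK _ b0).
Qed.

Lemma weyl_word f : weyl dot D f ->
  exists2 l, [set` l] `<=` simple_roots P & f = refl_word dot l.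
Proof.
elim=> [|a Da|{}f g _ [l lS fE] _ [l' lS' gE]|{}f _ [l lS fE]].
- by exists [::].
- exact: reflection_word.
- exists (l ++ l'); first by move=> x /=; rewrite mem_cat => /orP[/lS|/lS'].
  by apply/lfunP => v; rewrite comp_lfunE refl_word_cat fE gE.
- have rlS : [set` rev l] `<=` simple_roots P by move=> x /=; rewrite mem_rev => /lS.
  exists (rev l) => //.
  have fK : cancel (refl_word dot (rev l)) f.
    by rewrite fE; apply: refl_word_revK; apply: simple_nz.
  (* [f^-1] cancels [f] only when the kernel is trivial; the reversed word provides the left inverse
     that shows it. *)
  have f0 : lker f == 0%VS.
    apply/lker0P; rewrite fE; apply: (can_inj (g := refl_word dot (rev l))).
    by apply: refl_wordK; apply: simple_nz.
  by apply/lfunP => v; rewrite -{1}(fK v) lker0_lfunK.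
Qed.

Lemma refl_word_deletion l a : [set` l] `<=` simple_roots P -> simple_roots P a ->
  P (- refl_word dot l a) ->
  exists l', [/\ [set` l'] `<=` simple_roots P, (size l').+1 = size l
    & forall v, refl_word dot l (reflection dot a v) = refl_word dot l' v].
Proof.
move=> + Sa; elim: l => [|b l IH] lS.
  by rewrite refl_word_nil => /(posN Ppos (simple_pos Sa)).
have {}Sb : simple_roots P b by apply/lS/mem_head.
have {}lS : [set` l] `<=` simple_roots P.
  by move=> x xl; apply: lS; rewrite /= inE xl orbT.
rewrite refl_word_cons => PN.
have Dla : D (refl_word dot l a).
  by apply: refl_word_root; [exact: simple_words | exact: simple_root].
have [Pla|/(IH lS)[l' [lS' sl lE]]] := root_posVneg Ppos Dla; last first.
  exists (b :: l'); split; last by move=> v; rewrite !refl_word_cons lE.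
    by move=> x /=; rewrite inE => /orP[/eqP->|/lS'].
  by rewrite /= sl.
have lab : refl_word dot l a = b.
  apply: contrapT => /(simple_reflection_pos Droot Ppos Dred Sb Pla).
  by move=> /(posN Ppos)/(_ PN).
exists l; split=> // v; rewrite refl_word_cons.
rewrite reflection_conj; last exact/refl_word_isometric/simple_nz.
by rewrite lab reflectionK // (root_nz Droot (simple_root Sb)).
Qed.

(** If a nonempty word [rcons l a] preserves [P], then [l] sends [a] to a negative root, and
    deletion rewrites the product with two letters fewer. *)
Lemma refl_word_pos_id l : [set` l] `<=` simple_roots P ->
  (forall a, P a -> P (refl_word dot l a)) -> refl_word dot l = \1%VF.
Proof.
have [n] := ubnP (size l); elim: n l => // n IH l.
case/lastP: l => [|l a] //; rewrite size_rcons ltnS => sl laS lP.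
have Sa : simple_roots P a by apply: laS; rewrite /= mem_rcons mem_head.
have lS : [set` l] `<=` simple_roots P.
  by move=> x xl; apply: laS; rewrite /= mem_rcons inE xl orbT.
have PN : P (- refl_word dot l a).
  have := lP a (simple_pos Sa); rewrite refl_word_rcons reflection_id ?linearN //.
  exact: (root_nz Droot (simple_root Sa)).
have [l' [lS' sl' lE]] := refl_word_deletion lS Sa PN.
have wE : refl_word dot (rcons l a) = refl_word dot l'.
  by apply/lfunP => v; rewrite refl_word_rcons lE.
by move: lP; rewrite wE => lP'; apply: IH => //; rewrite -ltnS sl' ltnW.
Qed.

Lemma weyl_root w a : weyl dot D w -> D a -> D (w a).
Proof.
by move=> /weyl_word[l lS ->]; apply: refl_word_root; apply: simple_words.
Qed.

(** The inverse of [w] followed by [w'] preserves [P], hence is trivial: for a positive root written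
    as [w x], equality of the inversion sets makes [w' x] positive whatever the sign of [x]. *)
Lemma weyl_inversions_inj w w' : weyl dot D w -> weyl dot D w' ->
  inversions P w = inversions P w' -> w = w'.
Proof.
move=> Ww Ww' wE; have [l lS lE] := weyl_word Ww; have [l' lS' lE'] := weyl_word Ww'.
have rlS : [set` rev l] `<=` simple_roots P by move=> x /=; rewrite mem_rev => /lS.
have wK : cancel w (refl_word dot (rev l)).
  by rewrite lE; apply: refl_wordK; apply: simple_nz.
have Kw : cancel (refl_word dot (rev l)) w.
  by rewrite lE; apply: refl_word_revK; apply: simple_nz.
have u1 : refl_word dot (l' ++ rev l) = \1%VF.
  apply: refl_word_pos_id => [x /=|a Pa]; first by rewrite mem_cat => /orP[/lS'|/rlS].
  rewrite refl_word_cat -lE'; set x := refl_word dot (rev l) a.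
  have Dx : D x by apply: refl_word_root; [exact: simple_words | exact: pos_root Pa].
  have wx : w x = a by apply: Kw.
  have [Px|Px] := root_posVneg Ppos Dx.
    have [//|PN] := root_posVneg Ppos (weyl_root Ww' Dx).
    have : inversions P w' x by [].
    by rewrite -wE => -[_]; rewrite wx => /(posN Ppos Pa).
  have : inversions P w (- x) by split=> //; rewrite linearN /= opprK wx.
  by rewrite wE => -[_]; rewrite linearN opprK.
by apply/lfunP => v; rewrite -{2}(wK v) lE' -refl_word_cat u1 id_lfunE.
Qed.

Lemma simple_reflection_positive_system a P' : simple_roots P a ->
  positive_system D P' -> positive_system D [set v | P' (reflection dot a v)].
Proof.
move=> Sa Ppos'; have Da := simple_root Sa; have a0 := root_nz Droot Da.
have sD v : D v -> D (reflection dot a v) by apply: root_refl.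
have sD' v : D (reflection dot a v) -> D v.
  by move=> /sD; rewrite (reflectionK _ a0).
split.
- apply/seteqP; split=> [v /sD/(root_posVneg Ppos')[?|PN]|v [Pv|[u Pu <-]]].
  + by left.
  + by right; exists (- v); rewrite ?opprK //= linearN.
  + exact/sD'/(pos_root Ppos').
  + exact/(rootN Droot)/sD'/(pos_root Ppos').
- rewrite -subset0 => v [/= Pv [u /= Pu uE]]; apply: (posN Ppos' Pu).
  by rewrite -linearN uE.
- move=> u v /= Pu Pv Duv; rewrite linearD; apply: (pos_closed Ppos') => //.
  by rewrite -linearD; apply: sD.
Qed.

(* Any two positive systems are conjugate: reflecting in a simple root of [P]
   that is negative for [P'] lowers the number of positive roots of [P] that are
   negative for [P']. *)
Lemma positive_system_conj P' : positive_system D P' ->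
  exists2 l, [set` l] `<=` simple_roots P & forall v, P' v <-> P (refl_word dot l v).
Proof.
have /finite_seqP[s0 DE0] := root_finite Droot.
pose s := undup s0; have DE x : D x <-> x \in s by rewrite DE0 /s /= mem_undup.
pose neg (A : set V) := [seq b <- s | `[< P b /\ A (- b) >]].
have [n] := ubnP (size (neg P')); elim: n P' => // n IH P'; rewrite ltnS => sn Ppos'.
have [SP'|/existsNP[a /not_implyP[Sa NP'a]]] :=
    pselect (forall a, simple_roots P a -> P' a).
  exists [::] => // v; rewrite refl_word_nil.
  (* Once [P'] contains the simple roots of [P] it contains [P], and nested positive systems of [D]
     coincide. *)
  have PP' u : P u -> P' u.
    move=> Pu; have [l lS uE] := pos_simple_sum Droot Ppos Pu.
    rewrite uE; apply: (root_sum_pos Droot Ppos') => [|x /lS/SP'//].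
    by rewrite -uE; apply: pos_root Pu.
  split=> [Pv|/PP'//]; have [//|/PP'] := root_posVneg Ppos (pos_root Ppos' Pv).
  by move=> /(posN Ppos' Pv).
have Da := simple_root Sa; have a0 := root_nz Droot Da; have Pa := simple_pos Sa.
have [//|P'Na] := root_posVneg Ppos' Da.
pose P2 := [set v | P' (reflection dot a v)].
have Ppos2 : positive_system D P2 by apply: simple_reflection_positive_system.
have [] := IH P2 _ Ppos2.
  (* The reflection in [a] maps [neg P2] injectively into [neg P'], and the image misses [a], which
     lies in [neg P']. *)
  apply: leq_trans sn; rewrite -[X in (X < _)%N](size_map (reflection dot a)).
  rewrite -/(size (a :: map (reflection dot a) (neg P2))); apply: uniq_leq_size.
    rewrite /= map_inj_uniq ?filter_uniq ?undup_uniq ?andbT //; last first.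
      exact: (can_inj (reflectionK _ a0)).
    apply/mapP => -[b]; rewrite mem_filter => /andP[/asboolP[Pb _] _] aE.
    apply: (posN Ppos Pa).
    by rewrite -(reflection_id dot a0) {2}aE (reflectionK _ a0).
  move=> x; rewrite inE => /orP[/eqP->|/mapP[b]].
    by rewrite mem_filter; apply/andP; split; [apply/asboolP | apply/DE].
  rewrite mem_filter => /andP[/asboolP[Pb P2b] _] ->.
  have bNa : b <> a.
    by move=> ba; move: P2b; rewrite /P2 /= linearN /= ba reflection_id // opprK.
  have Psb := simple_reflection_pos Droot Ppos Dred Sa Pb bNa.
  rewrite mem_filter; apply/andP; split; last exact/DE/(pos_root Ppos).
  by apply/asboolP; split=> //; rewrite -linearN.
move=> l lS lE; exists (rcons l a).
  by move=> x /=; rewrite mem_rcons inE => /orP[/eqP->|/lS].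
move=> v; rewrite refl_word_rcons -lE /P2 /= (reflectionK _ a0) //.
Qed.

Definition sum_closed (A : set V) :=
  forall a b, A a -> A b -> D (a + b) -> A (a + b).

(** If w carries [P'] onto [P], a positive root v is inverted by w exactly when -v lies in [P'],
    that is, when v lies in [B]. *)
Lemma biconvex_inversions B : B `<=` P -> sum_closed B -> sum_closed (P `\` B) ->
  exists2 w, weyl dot D w & inversions P w = B.
Proof.
move=> BP Bc Bco; pose P' := (P `\` B) `|` [set b | B (- b)].
(* If the sum is in [B], so is [a = (a + b) + (- b)]; if it is negative and its opposite is outside
   [B], so is [- b = a + (- (a + b))]. Both are absurd. *)
have mixed a b : (P `\` B) a -> B (- b) -> D (a + b) -> P' (a + b).
  move=> [Pa NBa] Bb Dab; have [Pab|PN] := root_posVneg Ppos Dab.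
    left; split=> // Bab; apply: NBa; rewrite -(addrK b a); apply: Bc => //.
    by rewrite addrK; apply: pos_root Pa.
  right; apply: contrapT => NBab.
  have := Bco a (- (a + b)) (conj Pa NBa) (conj PN NBab).
  rewrite opprD addrA subrr add0r => /(_ (pos_root Ppos (BP _ Bb))) [_].
  exact.
have Ppos' : positive_system D P'.
  split.
  - apply/seteqP; split=> [v Dv|v [|[u + <-]]].
    + have [Pv|Pv] := root_posVneg Ppos Dv.
        have [Bv|NBv] := pselect (B v); last by left; left.
        by right; exists (- v); rewrite ?opprK //; right; rewrite /= opprK.
      have [Bv|NBv] := pselect (B (- v)); first by left; right.
      by right; exists (- v); rewrite ?opprK //; left.
    + case=> [[Pv _]|/BP Pv]; first exact: pos_root Pv.
      by rewrite -(opprK v); apply/(rootN Droot)/(pos_root Ppos).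
    + case=> [[Pu _]|/BP Pu]; last exact: pos_root Pu.
      exact/(rootN Droot)/(pos_root Ppos).
  - rewrite -subset0 => v [+ [u + uE]]; rewrite -{v}uE.
    case=> [[Pv NBv]|Bv] [[Pu NBu]|Bu].
    + exact: (posN Ppos Pu Pv).
    + exact: NBv.
    + by apply: NBu; rewrite /= opprK in Bv.
    + by rewrite /= opprK in Bv; apply: (posN Ppos (BP _ Bv)); apply: BP.
  - move=> a b [[Pa NBa]|Ba] [[Pb NBb]|Bb] Dab.
    + by left; apply: Bco.
    + exact: mixed.
    + by rewrite addrC; apply: mixed => //; rewrite addrC.
    + by right; rewrite /= opprD; apply: Bc => //; rewrite -opprD; apply: (rootN Droot).
have [l lS lE] := positive_system_conj Ppos'.
exists (refl_word dot l); first exact/refl_word_weyl/simple_words.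
apply/seteqP; split=> [v [Pv]|v Bv].
  rewrite -linearN => /lE [[PNv _]|]; first by case: (posN Ppos Pv).
  by rewrite /= opprK.
by split; [exact: BP | rewrite -linearN; apply/lE; right; rewrite /= opprK].
Qed.

Lemma inversions_sum_closed w : weyl dot D w -> sum_closed (inversions P w).
Proof.
move=> Ww a b [Pa Pwa] [Pb Pwb] Dab; split; first exact: (pos_closed Ppos).
rewrite linearD opprD; apply: (pos_closed Ppos) => //; rewrite -opprD -linearD.
exact/(rootN Droot)/weyl_root.
Qed.

Lemma noninversions_sum_closed w : weyl dot D w -> sum_closed (P `\` inversions P w).
Proof.
move=> Ww a b [Pa Na] [Pb Nb] Dab; split; first exact: (pos_closed Ppos).
have pos x : P x -> ~ inversions P w x -> P (w x).
  move=> Px Nx; have [//|PN] := root_posVneg Ppos (weyl_root Ww (pos_root Ppos Px)).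
  by case: Nx.
have Pw : P (w (a + b)).
  rewrite linearD; apply: (pos_closed Ppos); [exact: pos | exact: pos |].
  by rewrite -linearD; apply: weyl_root.
by move=> [_ /(posN Ppos Pw)].
Qed.

End Simple.
End WeylGroup.

(** * The set <J> generated by a set [J] of positive roots *)

Section Generation.
Context (R : realType) (V : vectType R) (dot : {dot V for idfun}).
Context (D : set V) (Droot : root_system dot D).
Context (P : set V) (Ppos : positive_system D P).
Implicit Types (a b u v x : V) (l : seq V) (J : set V).

Lemma root_gen_self J : J `<=` root_gen D J.
Proof. by move=> x Jx; exists 0%N. Qed.

Lemma root_gen_sum J v : root_gen D J v ->
  exists l, [/\ l != [::], [set` l] `<=` J & v = \sum_(x <- l) x].
Proof.
case=> n _; elim: n v => [|n IH] v /=.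
  move=> Jv; exists [:: v]; split=> //; last by rewrite big_seq1.
  by move=> x /=; rewrite inE => /eqP->.
case=> -[x Jx [y /IH[l [l0 lJ ->]] <-]] _; exists (x :: l); split=> //.
  by move=> z /=; rewrite inE => /orP[/eqP->|/lJ].
by rewrite big_cons.
Qed.

Section Subset.
Context (J : set V) (JP : J `<=` P).

Lemma root_gen_root v : root_gen D J v -> D v.
Proof. by case=> -[_ /JP/(pos_root Ppos)|n _ []]. Qed.

Lemma root_gen_pos v : root_gen D J v -> P v.
Proof.
move=> Jv; have Dv := root_gen_root Jv; move: Jv Dv.
move=> /root_gen_sum[l [_ lJ ->]] Dv; apply: (root_sum_pos Droot Ppos) => //.
exact: subset_trans lJ JP.
Qed.

(* A root that is a sum of elements of [J] can be peeled one summand at a time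
   while remaining a root: some summand has positive inner product with it. *)
Lemma root_sum_peel l v : D v -> l != [::] -> [set` l] `<=` J ->
    v = \sum_(x <- l) x ->
  J v \/ exists x l', [/\ J x, 0 < dot v x, D (v - x),
    [/\ l' != [::], [set` l'] `<=` J & v - x = \sum_(x <- l') x] & (size l' < size l)%N].
Proof.
move=> Dv l0 lJ vE.
have : 0 < dot v v by rewrite dot_gt0 (root_nz Droot Dv).
rewrite {2}vE => /dot_sum_gt0[x xl vx]; have Jx := lJ _ xl.
have vE' : v = x + \sum_(y <- rem x l) y by rewrite vE (big_rem x).
have rJ : [set` rem x l] `<=` J by move=> y /= /mem_rem/lJ.
have [r0|r0] := eqVneq (rem x l) [::].
  by left; rewrite vE' r0 big_nil addr0.
have vxE : v - x = \sum_(y <- rem x l) y by rewrite vE' addrAC subrr add0r.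
right; exists x, (rem x l); split=> //; last by rewrite size_rem //; case: (l) xl.
apply: (root_sub Droot Dv (pos_root Ppos (JP Jx)) vx) => vx0.
have := pos_sum_neq0 Droot Ppos r0 (subset_trans rJ JP).
by rewrite -vxE vx0 subrr eqxx.
Qed.

(** In the powers of [J] every partial sum must be a root; peeling orders an arbitrary list of
    summands so that this holds. *)
Lemma root_genP v : root_gen D J v <->
  D v /\ exists l, [/\ l != [::], [set` l] `<=` J & v = \sum_(x <- l) x].
Proof.
split=> [Jv|[Dv [l [l0 lJ vE]]]].
  by split; [exact: root_gen_root | exact: root_gen_sum].
have [n] := ubnP (size l).
elim: n l v Dv l0 lJ vE => // n IH l v Dv l0 lJ vE sl.
have [Jv|[x [l' [Jx _ Dvx [l'0 l'J vxE] sl']]]] := root_sum_peel Dv l0 lJ vE.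
  exact: root_gen_self.
have [k _ kv] := IH l' (v - x) Dvx l'0 l'J vxE (leq_trans sl' sl).
by exists k.+1 => //; split=> //; exists x => //; exists (v - x); rewrite ?subrKC.
Qed.

Lemma root_gen_sum_closed : sum_closed D (root_gen D J).
Proof.
move=> a b /root_gen_sum[l [l0 lJ ->]] /root_gen_sum[l' [_ lJ' ->]] Dab.
apply/root_genP; split=> //; exists (l ++ l'); rewrite big_cat; split=> //.
  by case: (l) l0.
by move=> x /=; rewrite mem_cat => /orP[/lJ|/lJ'].
Qed.

(** Induction on the number of summands. It keeps (v, x) > 0 at hand, which decides from which of
    [a] and [b] the root [x] can be subtracted when v = a + b. *)
Lemma root_gen_ind (Q : V -> Prop) :
  (forall v, J v -> Q v) ->
  (forall v x, root_gen D J v -> J x -> 0 < dot v x -> root_gen D J (v - x) ->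
    Q (v - x) -> Q v) ->
  forall v, root_gen D J v -> Q v.
Proof.
move=> Q0 QS v /root_genP[Dv [l [l0 lJ vE]]]; have [n] := ubnP (size l).
elim: n l v Dv l0 lJ vE => // n IH l v Dv l0 lJ vE sl.
have [/Q0//|[x [l' [Jx vx Dvx [l'0 l'J vxE] sl']]]] := root_sum_peel Dv l0 lJ vE.
apply: (QS _ x) => //; first by apply/root_genP; split=> //; exists l.
  by apply/root_genP; split=> //; exists l'.
by apply: (IH l') => //; apply: leq_trans sl' sl.
Qed.

End Subset.

Lemma root_gen_min (J A : set V) : J `<=` A -> sum_closed D A -> root_gen D J `<=` A.
Proof.
move=> JA Ac v [n _]; elim: n v => [|n IH] v; first exact: JA.
by case=> -[x /JA Ax [y /IH Ay <-]] Dxy; apply: Ac.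
Qed.

(** * Degrees of positive roots and of their sums *)

Section Graded.
Context (Dg : int -> set V) (Dgr : Zgrading D Dg) (Pcomp : compatible Dg P).

Lemma degree_uniq i j v : Dg i v -> Dg j v -> i = j.
Proof. by move=> iv jv; apply: (gr_disj Dgr) => //; exists v. Qed.

Lemma pos_degree v : P v -> exists2 i, 0 <= i & Dg i v.
Proof.
rewrite {1}(proj2 Pcomp) => -[[v0 _]|[i /= i1 iv]]; first by exists 0.
by exists i => //; apply: le_trans i1.
Qed.

Lemma ge1_pos v : gr_ge1 Dg v -> P v.
Proof. by move=> ?; rewrite (proj2 Pcomp); right. Qed.

Lemma degree1_pos v : Dg 1 v -> P v.
Proof. by move=> v1; apply: ge1_pos; exists 1. Qed.

Lemma ge1_degree v i : gr_ge1 Dg v -> Dg i v -> 1 <= i.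
Proof. by case=> j /= j1 jv iv; rewrite (degree_uniq iv jv). Qed.

Lemma pos_degree0_or_ge1 v : P v -> gr0_pos Dg P v \/ gr_ge1 Dg v.
Proof. by rewrite {1}(proj2 Pcomp). Qed.

Lemma root_pow_degree J n v : J `<=` Dg 1 -> root_pow D J n v -> Dg n.+1%:Z v.
Proof.
move=> J1; elim: n v => [|n IH] v; first exact: J1.
by case=> -[x /J1 x1 [y /IH yn <-]] Dxy; have := gr_add Dgr x1 yn Dxy; rewrite -intS.
Qed.

Lemma root_gen_degree1 J : J `<=` Dg 1 -> root_gen D J `&` Dg 1 = J.
Proof.
move=> J1; apply/seteqP; split=> [v [[n _ nv] v1]|v Jv]; last first.
  by split; [exact: root_gen_self | exact: J1].
by have := degree_uniq v1 (root_pow_degree J1 nv); case: n nv.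
Qed.

Lemma root_gen_ge1 J : J `<=` Dg 1 -> root_gen D J `<=` gr_ge1 Dg.
Proof. by move=> J1 v [n _ /(root_pow_degree J1) nv]; exists n.+1%:Z. Qed.

(** Positive roots have nonnegative degrees and degrees add, so 1 can only split as 1 + 0 or 0 +
    1. *)
Lemma degree_sum1 a b : P a -> P b -> Dg 1 (a + b) ->
  (Dg 1 a /\ gr0_pos Dg P b) \/ (gr0_pos Dg P a /\ Dg 1 b).
Proof.
move=> Pa Pb ab1; have [i i0 ia] := pos_degree Pa; have [j j0 jb] := pos_degree Pb.
have Dab : D (a + b) by rewrite (gr_union Dgr); exists 1.
have ij := degree_uniq ab1 (gr_add Dgr ia jb Dab).
have [i1|i1] := eqVneq i 1.
  by left; split; [rewrite -i1 | split=> //; rewrite (_ : 0 = j) //; lia].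
have i00 : i = 0 by lia.
by right; split; [split=> //; rewrite -i00 | rewrite (_ : 1 = j) //; lia].
Qed.

(** * Biconvexity of <I> and of Delta(>= 1) \ <I^c> *)

Section LowerIdeal.
Context (I : set V) (Ideal : lower_ideal Dg P I).

Let I1 : I `<=` Dg 1. Proof. by case: Ideal. Qed.
Let IP : I `<=` P. Proof. by move=> x /I1/degree1_pos. Qed.
Let J := Dg 1 `\` I.
Let J1 : J `<=` Dg 1. Proof. by move=> x []. Qed.
Let JP : J `<=` P. Proof. by move=> x /J1/degree1_pos. Qed.

(** The summand of degree 1 differs from [a + b] by a positive root, so it lies below it and belongs
    to the ideal. *)
Lemma ideal_split a b : P a -> P b -> I (a + b) ->
  (I a /\ gr0_pos Dg P b) \/ (gr0_pos Dg P a /\ I b).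
Proof.
move=> Pa Pb Iab; case: (degree_sum1 Pa Pb (I1 Iab)) => -[a' b']; [left|right].
  by split=> //; apply: (proj2 Ideal _ _ a' Iab); apply: (pos_root_le Droot Ppos).
split=> //; apply: (proj2 Ideal _ _ b' Iab); rewrite addrC.
exact: (pos_root_le Droot Ppos).
Qed.

Lemma ideal_compl_add a b : gr0_pos Dg P a -> J b -> D (a + b) -> J (a + b).
Proof.
move=> [a0 Pa] [b1 NIb] Dab; split; first by have := gr_add Dgr a0 b1 Dab.
move=> Iab; apply: NIb; apply: (proj2 Ideal _ _ b1 Iab); rewrite addrC.
exact: (pos_root_le Droot Ppos).
Qed.

Lemma root_gen_ideal_coclosed : sum_closed D (P `\` root_gen D I).
Proof.
move=> a b [Pa NIa] [Pb NIb] Dab; split; first exact: (pos_closed Ppos).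
move=> Iab; suff H v : root_gen D I v -> forall a b, a + b = v -> P a -> P b ->
    root_gen D I a \/ root_gen D I b.
  by have [] := H _ Iab _ _ erefl Pa Pb.
elim/(root_gen_ind IP) => {a b Pa NIa Pb NIb Dab Iab} {}v
  => [Iv|x Jv Ix vx Jvx IH] a b abE Pa Pb.
  by case: (ideal_split Pa Pb); rewrite ?abE // => -[? ?]; [left|right];
    apply: root_gen_self.
wlog ax : a b abE Pa Pb / 0 < dot a x.
  move=> W; have : 0 < dot a x \/ 0 < dot b x.
    move: vx; rewrite -abE linearDl /=; case: (ltP 0 (dot a x)); first by left.
    by move=> ? ?; right; lra.
  by case=> [/W|bx]; [exact | apply/or_comm; apply: W => //; rewrite addrC].
have [<-|/eqP aNx] := eqVneq x a; first by left; apply: root_gen_self.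
have Dax : D (a - x).
  apply: (root_sub Droot) => //; [exact: pos_root Pa|exact/(pos_root Ppos)/IP|].
  by move=> xa; apply: aNx.
have vxE : a - x + b = v - x by rewrite -abE addrAC.
have [Pax|] := root_posVneg Ppos Dax.
  have [Iax|] := IH _ _ vxE Pax Pb; last by right.
  left; rewrite -(subrK x a); apply: (root_gen_sum_closed IP) => //.
    exact: root_gen_self.
  by rewrite subrK; apply: pos_root Pa.
(* Now [x = a + (x - a)] splits inside [I]: either [a] is in [I], or [x - a] is, and then
   [b = (v - x) + (x - a)] is in <I>. *)
rewrite opprB => Pxa.
have [|[Ia _]|[_ Ixa]] := ideal_split Pa Pxa; first by rewrite subrKC.
  by left; apply: root_gen_self.
have bE : b = (v - x) + (x - a) by rewrite -abE addrA subrK addrAC subrr add0r.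
right; rewrite bE; apply: (root_gen_sum_closed IP) => //.
  exact: root_gen_self.
by rewrite -bE; apply: pos_root Pb.
Qed.

(** Peel [x] off [b]. If (a, x) < 0, then [a + x] is in [J] and can be added to [b - x]; otherwise
    (a + b, x) > 0, so [a + (b - x)] is a root and induction applies. *)
Lemma root_gen_compl_add a b : gr0_pos Dg P a -> root_gen D J b -> D (a + b) ->
  root_gen D J (a + b).
Proof.
move=> a0 Jb; have Pa := proj2 a0; have Da := pos_root Ppos Pa.
elim/(root_gen_ind JP): Jb => {}b => [Jb|x Gb Jx bx Gbx IH] Dab.
  by apply: root_gen_self; apply: ideal_compl_add.
have Px := JP Jx; have Dx := pos_root Ppos Px; have Pbx := root_gen_pos JP Gbx.
have [ax|ax] := ltP (dot a x) 0.
  have abE : a + b = (a + x) + (b - x) by rewrite addrACA subrr addr0.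
  rewrite abE; apply: (root_gen_sum_closed JP) => //; last by rewrite -abE.
  apply/root_gen_self/ideal_compl_add => //; apply: (root_add Droot) => //.
  exact: (pos_add_neq0 Ppos).
have abE : a + b - x = a + (b - x) by rewrite addrA.
rewrite -(subrK x (a + b)); apply: (root_gen_sum_closed JP).
- rewrite abE; apply: IH; rewrite -abE; apply: (root_sub Droot) => //.
    by rewrite linearDl /=; lra.
  move=> abx; have := pos_add_neq0 Ppos Pa Pbx.
  by rewrite -abE abx subrr eqxx.
- exact: root_gen_self.
- by rewrite subrK.
Qed.

(** The descent used for <I> works again, with degrees in place of the ideal property: a root of
    degree 1 is no sum of two roots of degree at least 1, and a difference of degree 0 is absorbed
    by [root_gen_compl_add]. *)
Lemma root_gen_compl_coclosed a b : gr_ge1 Dg a -> gr_ge1 Dg b ->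
  root_gen D J (a + b) -> root_gen D J a \/ root_gen D J b.
Proof.
suff H v : root_gen D J v -> forall a b, a + b = v -> gr_ge1 Dg a -> gr_ge1 Dg b ->
    root_gen D J a \/ root_gen D J b.
  by move=> a1 b1 /H/(_ a b erefl); apply.
elim/(root_gen_ind JP) => {a b} {}v => [Jv|x Gv Jx vx Gvx IH] a b abE a1 b1.
  have v1 := J1 Jv; case: (a1) (b1) => i /= i1 ia [j /= j1 jb].
  have := gr_add Dgr ia jb; rewrite abE => /(_ (pos_root Ppos (JP Jv))).
  by move=> /(degree_uniq v1) ijE; lia.
wlog ax : a b abE a1 b1 / 0 < dot a x.
  move=> W; have : 0 < dot a x \/ 0 < dot b x.
    move: vx; rewrite -abE linearDl /=; case: (ltP 0 (dot a x)); first by left.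
    by move=> ? ?; right; lra.
  by case=> [/W|bx]; [exact | apply/or_comm; apply: W => //; rewrite addrC].
have Pa := ge1_pos a1; have Pb := ge1_pos b1.
have [<-|/eqP aNx] := eqVneq x a; first by left; apply: root_gen_self.
have Dax : D (a - x).
  apply: (root_sub Droot) => //; [exact: pos_root Pa|exact/(pos_root Ppos)/JP|].
  by move=> xa; apply: aNx.
have vxE : a - x + b = v - x by rewrite -abE addrAC.
have axE : a = a - x + x by rewrite subrK.
have [Pax|] := root_posVneg Ppos Dax.
  have [ax0|ax1] := pos_degree0_or_ge1 Pax.
    left; rewrite axE; apply: root_gen_compl_add => //; first exact: root_gen_self.
    by rewrite -axE; apply: pos_root Pa.
  have [Jax|] := IH _ _ vxE ax1 b1; last by right.
  left; rewrite axE; apply: (root_gen_sum_closed JP) => //.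
    exact: root_gen_self.
  by rewrite -axE; apply: pos_root Pa.
rewrite opprB => Pxa.
have xE : a + (x - a) = x by rewrite subrKC.
(* As [a] has degree at least 1, it has degree 1 and [x - a] has degree 0, so [b] is [v - x] plus a
   positive root of degree 0. *)
have [|[_ xa0]|[a0 _]] := degree_sum1 Pa Pxa; first by rewrite xE; apply: J1.
  have bE : b = (x - a) + (v - x) by rewrite -abE addrC addrA subrK addrAC subrr add0r.
  right; rewrite bE; apply: root_gen_compl_add => //.
  by rewrite -bE; apply: pos_root Pb.
by have := ge1_degree a1 (proj1 a0).
Qed.

Lemma wmin_set_biconvex : [/\ root_gen D I `<=` P, sum_closed D (root_gen D I)
  & sum_closed D (P `\` root_gen D I)].
Proof.
split; [exact: root_gen_pos | exact: root_gen_sum_closed |].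
exact: root_gen_ideal_coclosed.
Qed.

Lemma wmax_set_biconvex : let B := gr_ge1 Dg `\` root_gen D J in
  [/\ B `<=` P, sum_closed D B & sum_closed D (P `\` B)].
Proof.
move=> B; split=> [v [/ge1_pos]//|a b [a1 NJa] [b1 NJb] Dab|].
  split; last by move=> /(root_gen_compl_coclosed a1 b1)[].
  case: a1 b1 => i /= i1 ia [j /= j1 jb]; exists (i + j); first by rewrite /=; lia.
  exact: (gr_add Dgr).
(* Outside [B] only positive roots of degree 0 and elements of <J> remain, so closure comes down to
   four cases. *)
have outB v : (P `\` B) v -> gr0_pos Dg P v \/ root_gen D J v.
  move=> [Pv NBv]; have [?|v1] := pos_degree0_or_ge1 Pv; first by left.
  by right; apply: contrapT => NJv; apply: NBv.
move=> a b aB bB Dab; split; first by apply: (pos_closed Ppos); [case: aB|case: bB|].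
case=> ab1 NJab.
have [a0|Ja] := outB _ aB; have [b0|Jb] := outB _ bB.
- have := ge1_degree ab1 (gr_add Dgr (proj1 a0) (proj1 b0) Dab); lia.
- by apply: NJab; apply: root_gen_compl_add.
- by apply: NJab; rewrite addrC; apply: root_gen_compl_add; rewrite // addrC.
- by apply: NJab; apply: (root_gen_sum_closed JP).
Qed.

End LowerIdeal.
End Graded.
End Generation.

Theorem theorem3p6 (R : realType) (V : vectType R) (dot : {dot V for idfun})
    (D : set V) (Dg : int -> set V) (P : set V)
    (Droot : root_system dot D) (Dred : reduced D) (Dirr : irreducible dot D)
    (Dgr : Zgrading D Dg) (Ppos : positive_system D P)
    (Pcomp : compatible Dg P)
    (I : set V) (Ideal : lower_ideal Dg P I) :
  exists wmin wmax : 'End(V),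
    [/\ unique (is_wmin dot D P I) wmin /\ unique (is_wmax dot D Dg P I) wmax,
        weyl0 dot D Dg P wmin /\ weyl0 dot D Dg P wmax,
        tau_fiber dot D Dg P I =
          [set w | [/\ weyl0 dot D Dg P w,
                       weak_le P wmin w & weak_le P w wmax]]
      & weak_interval P (weyl0 dot D Dg P) (tau_fiber dot D Dg P I)].
Proof.
have I1 : I `<=` Dg 1 by case: Ideal.
set J := Dg 1 `\` I; have J1 : J `<=` Dg 1 by move=> x [].
have [minP minc minco] := wmin_set_biconvex Droot Ppos Dgr Pcomp Ideal.
have [maxP maxc maxco] := wmax_set_biconvex Droot Ppos Dgr Pcomp Ideal.
have [wmin Wmin minE] := biconvex_inversions Droot Dred Ppos minP minc minco.
have [wmax Wmax maxE] := biconvex_inversions Droot Dred Ppos maxP maxc maxco.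
(* For w in W, membership in W^0 amounts to N(w) lying in Delta(>= 1); [weyl0I] and [weyl0_ge1] are
   the two directions. *)
have weyl0I w : weyl dot D w -> inversions P w `<=` gr_ge1 Dg -> weyl0 dot D Dg P w.
  move=> Ww Nw; split=> // a [a0 Pa].
  have [//|PN] := root_posVneg Ppos (weyl_root Droot Dred Ppos Ww (pos_root Ppos Pa)).
  by have /Nw/(ge1_degree Dgr)/(_ a0) : inversions P w a by [].
have weyl0_ge1 w : weyl0 dot D Dg P w -> inversions P w `<=` gr_ge1 Dg.
  move=> [Ww W0] v [Pv PNv]; have [v0|//] := pos_degree0_or_ge1 Pcomp Pv.
  by have /(posN Ppos) := W0 _ v0.
have Wmin0 : weyl0 dot D Dg P wmin.
  by apply: weyl0I => //; rewrite minE; apply: (root_gen_ge1 Dgr).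
have Wmax0 : weyl0 dot D Dg P wmax by apply: weyl0I => //; rewrite maxE => v [].
have genI : root_gen D I `&` Dg 1 = I by apply: (root_gen_degree1 Dgr).
have fiberE : tau_fiber dot D Dg P I =
    [set w | [/\ weyl0 dot D Dg P w, weak_le P wmin w & weak_le P w wmax]].
  apply/seteqP; split=> [w [Ww tauE]|w [Ww minw maxw]].
    have [Ww' _] := Ww; split; rewrite // /weak_le ?minE ?maxE.
      apply: root_gen_min; first by rewrite -tauE => v [].
      exact: (inversions_sum_closed Droot Dred).
    move=> v Nv; split; first exact: weyl0_ge1 Nv.
    (* The non-inversions contain I^c and are closed under sums of roots, so they contain <I^c>. *)
    have JN : J `<=` P `\` inversions P w.
      move=> x [x1 NIx]; split; first exact: (degree1_pos Pcomp).
      by move=> Nx; apply: NIx; rewrite -tauE.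
    have Nc := noninversions_sum_closed Droot Dred Ppos Ww'.
    by move=> /(root_gen_min JN Nc)[].
  (* In degree 1 the two bounds meet: [I] lies in N(w), while I^c lies in <I^c> and so outside
     N(w). *)
  rewrite /weak_le minE in minw; rewrite /weak_le maxE in maxw.
  split=> //; apply/seteqP; split=> [v [Nv v1]|v Iv]; last first.
    by split; [apply/minw/root_gen_self | apply: I1].
  have [_ NJv] := maxw _ Nv; apply: contrapT => NIv.
  exact/NJv/root_gen_self.
exists wmin, wmax; split=> //.
  split; split=> // w [Ww wE]; apply: (weyl_inversions_inj Droot Dred Ppos) => //.
    by rewrite minE wE.
  by rewrite maxE wE.
exists wmin, wmax; split=> //.
(* The remaining condition, that [wmin] is below [wmax], holds because [wmin] itself lies in the
   fiber. *)
suff : tau_fiber dot D Dg P I wmin by rewrite fiberE => -[].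
by split=> //; rewrite /tau minE.
Qed.
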